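(* Let $K$ be an infinite compact Hausdorff space. Then $K$ has a bidiscrete system of size $d(K)$. If moreover $K$ is 0-dimensional, then there is a very nice bidiscrete system in $K$ of size $d(K)$.
   Context: $d(K)$ denotes the density of $K$, i.e. the least cardinality of a dense subset of $K$. $C(K)$ is the set of continuous real-valued functions on $K$. A system $\{(x^0_\alpha,x^1_\alpha):\alpha<\kappa\}$ of pairs of points of $K$ (i.e. a subfamily of $K^2$) is a bidiscrete system in $K$ (of size $\kappa$) if there exist functions $f_\alpha\in C(K)$ ($\alpha<\kappa$) such that for all $\alpha,\beta<\kappa$: $f_\alpha(x^0_\alpha)=0$ and $f_\alpha(x^1_\alpha)=1$; and if $\alpha\ne\beta$ then $f_\alpha(x^0_\beta)=f_\alpha(x^1_\beta)$. For a 0-dimensional $K$ (one having a base of clopen sets), a bidiscrete system is very nice if the witnessing functions $f_\alpha$ can be chosen to take only the values $0$ and $1$; equivalently, if there are clopen sets $H_\alpha\subseteq K$ ($\alpha<\kappa$) such that each $H_\alpha$ separates $x^0_\alpha$ from $x^1_\alpha$ (contains exactly one of them) but for $\beta\neq\alpha$ does not separate $x^0_\beta$ from $x^1_\beta$. *)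

(* Defs.v *)
From HB Require Import structures.
From mathcomp Require Import all_boot all_order all_algebra.
From mathcomp Require Import all_classical all_reals all_analysis.
Import Order.TTheory GRing.Theory Num.Theory.
Import numFieldNormedType.Exports.

Set Implicit Arguments.
Unset Strict Implicit.
Unset Printing Implicit Defensive.

Local Open Scope classical_set_scope.
Local Open Scope card_scope.
Local Open Scope ring_scope.

(* [A] has cardinality [d(K)]. Cardinals are compared by injections, so
   "the least cardinality of a dense set" is the cardinality of a dense set
   that injects into every dense set; such a set exists by choice. *)
Definition has_density_card (K : topologicalType) (T : Type) (A : set T) :
    Prop :=
  exists D : set K,
    [/\ dense D, (forall E : set K, dense E -> D #<= E) & A #= D].

(* The library's [zero_dimensional] only asks that distinct points be
   separated by clopen sets. *)
Definition has_clopen_base (K : topologicalType) : Prop :=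
  exists B : set (set K), basis B /\ B `<=` clopen.

Definition bidiscrete_witness (R : realType) (K : topologicalType) (I : Type)
    (x0 x1 : I -> K) (f : I -> K -> R) : Prop :=
  [/\ forall a, continuous (f a),
      forall a, f a (x0 a) = 0 /\ f a (x1 a) = 1
    & forall a b, a <> b -> f a (x0 b) = f a (x1 b)].

Definition bidiscrete (R : realType) (K : topologicalType) (I : Type)
    (x0 x1 : I -> K) : Prop :=
  exists f : I -> K -> R, bidiscrete_witness x0 x1 f.

Definition very_nice_bidiscrete (R : realType) (K : topologicalType)
    (I : Type) (x0 x1 : I -> K) : Prop :=
  exists f : I -> K -> R,
    bidiscrete_witness x0 x1 f /\ forall a y, f a y = 0 \/ f a y = 1.

(* Main.v *)
(* Take a bidiscrete system S, a set of triples (x0, x1, f), that is infinite and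
   maximal. If x lies outside the closure of the points of S, then the functions
   of S separate x from every y <> x: otherwise (y, x), with a Urysohn function
   equal to 1 at x and vanishing at y and on that closure, would extend S. By
   compactness the finite intersections of the rational half spaces {f < q} and
   {f > q}, f in S, form a base at such points x. One point in each of these
   intersections together with the points of S is therefore a dense set, of
   cardinality at most |S|, so d(K) <= |S|. Only Urysohn functions are used, so
   with a clopen base all functions can be taken with values 0 and 1. *)
From HB Require Import structures.
Require Import Defs.
From mathcomp Require Import finmap all_boot all_order all_algebra.
From mathcomp Require Import all_classical all_reals all_analysis.
Import Order.TTheory GRing.Theory Num.Theory.
Import numFieldNormedType.Exports.

Set Implicit Arguments.
Unset Strict Implicit.
Unset Printing Implicit Defensive.

Local Open Scope classical_set_scope.
Local Open Scope card_scope.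
Local Open Scope ring_scope.

(** * Zorn's lemma and the comparison of cardinals *)

(** Zorn's lemma is applied to the sets whose union with [A0] satisfies [P]; the empty chain is then
    settled by [P A0], so only nonempty [F] are left to [Pcup]. *)
Lemma Zorn_bigcup_above (T : Type) (P : set (set T)) (A0 : set T) :
    P A0 ->
    (forall F : set (set T), F !=set0 -> F `<=` P -> total_on F subset ->
      P (\bigcup_(X in F) X)) ->
  exists A, [/\ A0 `<=` A, P A & forall B, A `<` B -> ~ P B].
Proof.
move=> PA0 Pcup.
have [F FP Ftot|A [PA maxA]] := @Zorn_bigcup T (fun X => P (A0 `|` X)).
  have [->|/set0P [X0 FX0]] := eqVneq F set0; first by rewrite bigcup_set0 setU0.
  have -> : A0 `|` \bigcup_(X in F) X =
            \bigcup_(Y in [set A0 `|` X | X in F]) Y.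
    rewrite bigcup_image; apply/seteqP; split=> x.
      by move=> [A0x|[X FX Xx]]; [exists X0 => //; left|exists X => //; right].
    by move=> [X FX [A0x|Xx]]; [left|right; exists X].
  apply: Pcup; first by exists (A0 `|` X0), X0.
    by move=> _ [X FX <-]; exact: FP.
  move=> _ _ [X FX <-] [Y FY <-].
  by have [XY|YX] := Ftot _ _ FX FY; [left|right]; exact: setUS.
exists (A0 `|` A); split=> // B; rewrite properEneq => -[neqAB AB] PB.
apply: (maxA B); last first.
  by have -> : A0 `|` B = B by apply/setUidPr => x A0x; apply: AB; left.
split; first by move=> x Ax; apply: AB; right.
move=> BA; move/eqP: neqAB; apply; apply/seteqP; split=> // x Bx.
by right; exact: BA.
Qed.

Lemma subset_of_two (T : Type) (F : set (set T)) (x y : T) :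
    total_on F subset -> (\bigcup_(X in F) X) x -> (\bigcup_(X in F) X) y ->
  exists X, [/\ F X, X x & X y].
Proof.
move=> Ftot [X FX Xx] [Y FY Yy].
by have [XY|YX] := Ftot _ _ FX FY; [exists Y|exists X]; split => //;
  [exact: XY|exact: YX].
Qed.

(* A maximal set [S] of selectors, any two of which differ at every index,
   exhausts some [E i]: otherwise one could pick a selector avoiding [S]. *)
Lemma card_le_least (X J : Type) (E : J -> set X) (j0 : J) :
  exists i, forall j, E i #<= E j.
Proof.
pose P (S : set (J -> X)) := (forall s, S s -> forall j, E j (s j)) /\
  (forall s t j, S s -> S t -> s j = t j -> s = t).
have [F FP Ftot|S [[SE Sinj] maxS]] := @Zorn_bigcup _ P.
  split=> [s [S FS Ss] j|s t j cs ct]; first exact: (FP _ FS).1.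
  have [S [FS Ss St]] := subset_of_two Ftot cs ct.
  by move=> st; apply: (FP _ FS).2 st.
have [i Ei] : exists i, E i `<=` (fun s => s i) @` S.
  apply: contrapT => /forallNP noti.
  have /choice [s0 s0P] : forall i, exists x, E i x /\ forall s, S s -> s i <> x.
    move=> i; have /existsNP [x /not_implyP [Eix Sx]] := noti i.
    by exists x; split=> // s Ss six; apply: Sx; exists s.
  apply: (maxS (s0 |` S)).
    split; first by move=> s; right.
    by move=> /(_ s0 (or_introl erefl)) /(s0P j0).2.
  split=> [s [->|/SE //] j|s t j]; first exact: (s0P j).1.
  move=> [->|Ss] [->|St] // st; last exact: Sinj st.
    by have := (s0P j).2 _ St; rewrite st.
  by have := (s0P j).2 _ Ss; rewrite st.
(* Evaluation at [i] maps [S] onto a set containing [E i], while evaluation at [j] embeds [S] into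
   [E j]. *)
exists i => j; apply: (card_le_trans (subset_card_le Ei)).
apply: (card_le_trans (card_image_le _ _)).
have /card_le_eql <- : (fun s : J -> X => s j) @` S #= S.
  by apply: inj_card_eq => s t; rewrite !inE => Ss St; exact: Sinj.
by apply: subset_card_le => _ [s Ss <-]; exact: SE.
Qed.

Lemma card_le_total (T : Type) (A B : set T) : A #<= B \/ B #<= A.
Proof.
have [[] leAB] := @card_le_least T bool (fun b => if b then A else B) true.
  by left; exact: (leAB false).
by right; exact: (leAB true).
Qed.

Lemma card_le_inj (T U : Type) (A : set T) (B : set U) (u0 : U) : A #<= B ->
  exists f : T -> U, (forall x, A x -> B (f x)) /\
    (forall x y, A x -> A y -> f x = f y -> x = y).
Proof.
move=> /card_leP [f]; exists (fun x =>
  if pselect (A x) is left Ax then val (f (SigSub (mem_set Ax))) else u0).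
split=> [x Ax|x y Ax Ay]; first by case: pselect => // ?; exact: set_valP.
case: pselect => // {}Ax; case: pselect => // {}Ay /val_inj.
by move=> /(@inj _ _ _ f); rewrite !inE => /(_ I I) [].
Qed.

(** * Pairs and finite sequences over an infinite type *)

(* |T|^2 = |T|: a maximal graph of an injection [A * A -> A] extending the one
   given by [pickle] on the range of [i] has |T \ A| <= |A|. *)
Section square.
Variables (T : Type) (i : nat -> T).
Hypothesis i_inj : injective i.

(** The graph of a map on [A * A] determines [A] through its diagonal, so Zorn's lemma can run over
    graphs alone. *)
Let fld (G : set ((T * T) * T)) : set T := [set a | exists c, G ((a, a), c)].

Let square_graph (G : set ((T * T) * T)) : Prop :=
  [/\ forall p c d, G (p, c) -> G (p, d) -> c = d,
      forall p q c, G (p, c) -> G (q, c) -> p = q,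
      forall p c, G (p, c) -> [/\ fld G p.1, fld G p.2 & fld G c]
    & forall a b, fld G a -> fld G b -> exists c, G ((a, b), c)].

Let fldS G H : G `<=` H -> fld G `<=` fld H.
Proof. by move=> GH a [c /GH]; exists c. Qed.

Let square_graph_bigcup (F : set (set ((T * T) * T))) :
    F `<=` square_graph -> total_on F subset ->
  square_graph (\bigcup_(X in F) X).
Proof.
move=> FP Ftot; split.
- move=> p c d pc pd; have [G [FG Gc Gd]] := subset_of_two Ftot pc pd.
  by have [H _ _ _] := FP _ FG; exact: H Gc Gd.
- move=> p q c pc qc; have [G [FG Gp Gq]] := subset_of_two Ftot pc qc.
  by have [_ H _ _] := FP _ FG; exact: H Gp Gq.
- move=> p c [G FG Gpc]; have [_ _ /(_ _ _ Gpc) [p1 p2 fc] _] := FP _ FG.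
  by split; apply: fldS (bigcup_sup FG) _ _.
- move=> a b [c ac] [d bd]; have [G [FG Ga Gb]] := subset_of_two Ftot ac bd.
  have [_ _ _ H] := FP _ FG.
  have [||e Ge] := H a b; [by exists c|by exists d|by exists e, G].
Qed.

Let G0 : set ((T * T) * T) :=
  [set z | exists m n : nat, z = ((i m, i n), i (pickle (m, n)))].

Let fldG0 n : fld G0 (i n). Proof. by exists (i (pickle (n, n))), n, n. Qed.

Let square_graph0 : square_graph G0.
Proof.
split.
- move=> p c d [m [n [-> ->]]] [m' [n' [/i_inj mm' /i_inj nn' ->]]].
  by rewrite mm' nn'.
- move=> p q c [m [n [-> ->]]] [m' [n' [->]]] /i_inj.
  by move=> /(pcan_inj pickleK) [-> ->].
- by move=> p c [m [n [-> ->]]]; split; exact: fldG0.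
- move=> a b [_ [m [_ [-> _ _]]]] [_ [n [_ [-> _ _]]]].
  by exists (i (pickle (m, n))), m, n.
Qed.

Lemma infinite_square : exists e : T * T -> T, injective e.
Proof.
have [|G [G0G [Gfun Ginj Gfld Gtot] maxG]] :=
  Zorn_bigcup_above square_graph0.
  by move=> F _; exact: square_graph_bigcup.
set A := fld G in Gfld Gtot.
have [t0A t1A] : A (i 0) /\ A (i 1) by split; apply: (fldS G0G); exact: fldG0.
have /choice [e eG] : forall p : T * T, exists c, A p.1 -> A p.2 -> G (p, c).
  move=> [a b]; have [[Aa Ab]|nAab] := pselect (A a /\ A b).
    by have [c Gc] := Gtot a b Aa Ab; exists c.
  by exists a => Aa Ab; case: nAab.
have eA a b : A a -> A b -> A (e (a, b)).
  by move=> Aa Ab; have [_ _] := Gfld _ _ (eG (a, b) Aa Ab).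
have e_inj a b c d : A a -> A b -> A c -> A d ->
    e (a, b) = e (c, d) -> (a, b) = (c, d).
  move=> Aa Ab Ac Ad eq_e; apply: Ginj (eG (a, b) Aa Ab) _.
  by rewrite eq_e; exact: eG.
(* [A] together with a disjoint copy of itself embeds into [A], the tags [i 0]
   and [i 1] telling the two apart. *)
have stack (B : set T) (v : T -> T) : (forall x, B x -> ~ A x -> A (v x)) ->
    (forall x y, B x -> B y -> ~ A x -> ~ A y -> v x = v y -> x = y) ->
  exists s : T -> T, (forall x, A x \/ B x -> A (s x)) /\
    (forall x y, A x \/ B x -> A y \/ B y -> s x = s y -> x = y).
  move=> vA v_inj.
  have i01 : i 0 <> i 1 by move=> /i_inj.
  exists (fun x => if pselect (A x) is left _ then e (i 0, x) else e (i 1, v x)).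
  split=> [x|x y].
    by case: pselect => [Ax|nAx] [] // Bx; apply: eA => //; exact: vA.
  case: pselect => [Ax|nAx]; case: pselect => [Ay|nAy] Hx Hy /e_inj eq_e.
  - by have [] := eq_e t0A Ax t0A Ay.
  - have Avy : A (v y) by apply: vA => //; case: Hy.
    by have [/i01] := eq_e t0A Ax t1A Avy.
  - have Avx : A (v x) by apply: vA => //; case: Hx.
    by have [/esym /i01] := eq_e t1A Avx t0A Ay.
  - have [Bx By] : B x /\ B y by case: Hx => //; case: Hy.
    have [] := eq_e t1A (vA x Bx nAx) t1A (vA y By nAy).
    exact: v_inj.
have [leA|leA] := card_le_total (~` A) A.
  (* If the complement of [A] embeds into [A], so does all of [T], and [e] then codes the pairs. *)
  have [v [vA v_inj]] := card_le_inj (i 0) leA.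
  have [x _|x y _ _|s [sA s_inj]] := stack setT v.
  - exact: vA.
  - exact: v_inj.
  exists (fun p => e (s p.1, s p.2)) => -[a b] [c d] /=.
  have sAT x : A (s x) by apply: sA; right.
  move=> /(e_inj _ _ _ _ (sAT a) (sAT b) (sAT c) (sAT d)) [sac sbd].
  by congr pair; apply: s_inj => //; right.
(* Otherwise [u] copies [A] into its complement. Let [C] be [A] with this copy. Pairs from [C] not
   both in [A] are given values in the copy, which extends [G] to [C * C] against maximality. *)
exfalso.
have [u [uA u_inj]] := card_le_inj (i 0) leA.
have /choice [v vP] : forall x, exists a, (u @` A) x -> A a /\ u a = x.
  by move=> x; have [[a Aa <-]|] := pselect ((u @` A) x); [exists a|exists x].
have [x /vP []//|x y /vP [_ vx] /vP [_ vy] _ _ vxy|s [sA s_inj]] :=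
  stack (u @` A) v; first by rewrite -vx vxy.
pose C : set T := A `|` u @` A.
pose H : set ((T * T) * T) := [set z | [/\ C z.1.1, C z.1.2,
  ~ (A z.1.1 /\ A z.1.2) & z.2 = u (e (s z.1.1, s z.1.2))]].
have uC x y : C x -> C y -> (u @` A) (u (e (s x, s y))).
  by move=> Cx Cy; exists (e (s x, s y)) => //; apply: eA; apply: sA.
have GA p c : G (p, c) -> A p.1 /\ A p.2 by move=> /Gfld [].
have fldC x : fld (G `|` H) x <-> C x.
  split=> [[c [/GA [Ax _]|[/= Cx _ _ _]]]|Cx] //; first by left.
  have [[c Gc]|nAx] := pselect (A x); first by exists c; left.
  by exists (u (e (s x, s x))); right; split => //= -[].
apply: (maxG (G `|` H)).
  split; first by left.
  have nAu : ~ A (u (i 0)) by exact: uA.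
  have Cu : C (u (i 0)) by right; exists (i 0).
  move=> /(_ ((u (i 0), u (i 0)), u (e (s (u (i 0)), s (u (i 0)))))) GuA.
  by have [|//] := GA _ _ (GuA _); right; split => //= -[].
split.
- move=> p c d [Gc|[/= C1 C2 nA cE]] [Gd|[/= D1 D2 nA' dE]].
  + exact: Gfun Gc Gd.
  + by case: nA'; exact: GA Gc.
  + by case: nA; exact: GA Gd.
  + by rewrite cE dE.
- have notA x y c : C x -> C y -> c = u (e (s x, s y)) -> ~ A c.
    move=> Cx Cy ->; have [a Aa <-] := uC x y Cx Cy; exact: uA.
  move=> [a b] [a' b'] c [Gc|[/= C1 C2 _ cE]] [Gd|[/= D1 D2 _ dE]].
  + exact: Ginj Gc Gd.
  + by have [_ _ /(notA _ _ _ D1 D2 dE)] := Gfld _ _ Gc.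
  + by have [_ _ /(notA _ _ _ C1 C2 cE)] := Gfld _ _ Gd.
  + have /u_inj := etrans (esym cE) dE.
    move=> /(_ (eA _ _ (sA _ C1) (sA _ C2)) (eA _ _ (sA _ D1) (sA _ D2))).
    move=> /(e_inj _ _ _ _ (sA _ C1) (sA _ C2) (sA _ D1) (sA _ D2)) [].
    by move=> /(s_inj _ _ C1 D1) -> /(s_inj _ _ C2 D2) ->.
- move=> p c [Gc|[/= C1 C2 _ ->]].
    by have [? ? ?] := Gfld _ _ Gc; split; apply/fldC; left.
  by split; apply/fldC => //; right; exact: uC.
- move=> a b /fldC Ca /fldC Cb.
  have [[Aa Ab]|nAab] := pselect (A a /\ A b).
    by have [c Gc] := Gtot a b Aa Ab; exists c; left.
  by exists (u (e (s a, s b))); right.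
Qed.

Lemma infinite_seq : exists g : seq T -> T, injective g.
Proof.
have [e e_inj] := infinite_square.
(* The tags [i 0] and [i 1] tell the empty list from the others. *)
pose g := fix g (l : seq T) : T :=
  if l is x :: l' then e (i 1, e (x, g l')) else e (i 0, i 0).
exists g; elim=> [|x l IH] [|y k] //=.
- by move=> /e_inj [/i_inj].
- by move=> /e_inj [/i_inj].
- by move=> /e_inj [/e_inj [-> /IH ->]].
Qed.

(** This bounds the number of finite families of half spaces: [T] becomes the system, and [C] the
    countably many labels of each triple. *)
Lemma infinite_seq_countable (C : countType) :
  exists g : seq (T * C) -> T, injective g.
Proof.
have [e e_inj] := infinite_square; have [g g_inj] := infinite_seq.
exists (fun l => g [seq e (p.1, i (pickle p.2)) | p <- l]).
move=> l k /g_inj; apply: inj_map => -[x c] [y d] /= /e_inj [-> /i_inj].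
by move=> /(pcan_inj pickleK) ->.
Qed.

End square.

Lemma card_leT_inj (T U : Type) (f : T -> U) : injective f ->
  [set: T] #<= [set: U].
Proof.
move=> f_inj; have /card_le_eql <- : f @` setT #= [set: T].
  by apply: inj_card_eq => x y _ _; exact: f_inj.
exact: card_leT.
Qed.

(** * Compactness and maximal bidiscrete systems *)

(* [compact_cover] is stated in the library for pointed spaces only. *)
Lemma compact_cover_compact (T : topologicalType) (p : T) (A : set T) :
  compact A -> cover_compact A.
Proof.
pose T' : ptopologicalType := HB.pack (Topological.sort T) (isPointed.Build T p).
by have := @compact_cover T'; rewrite predeqE => /(_ A) [].
Qed.

Section topology.
Variables (R : realType) (K : topologicalType).
Hypothesis Kinfinite : infinite_set [set: K].
Hypothesis Kcompact : compact [set: K].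
Hypothesis Khausdorff : hausdorff_space K.

(** Otherwise the singletons form an open cover, and a finite subcover makes [K] finite. *)
Lemma nonisolated_point : exists p : K, ~ open [set p].
Proof.
apply/existsNP => open1; apply: Kinfinite.
have [p _] := infinite_setN0 Kinfinite.
have /(_ K setT (@set1 K)) := compact_cover_compact p Kcompact.
case=> [i _|x _|D _ KD]; [exact: open1|by exists x|].
apply: sub_finite_set (finite_fset D) => x /KD [y Dy].
by rewrite /set1 /= => ->.
Qed.

Lemma closed_set1 (x : K) : closed [set x].
Proof. exact/accessible_closed_set1/hausdorff_accessible. Qed.

(* A triple [((x0, x1), f)] is a pair of points with its witnessing function. *)
Let triple : Type := (K * K * (K -> R))%type.

(** The class [Q] of admissible functions lets one argument serve both claims: continuous functions
    for the first, continuous functions with values 0 and 1 for the second. *)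
Variable Q : set (K -> R).
Hypothesis Qcontinuous : forall f, Q f -> continuous f.
Hypothesis Qseparates : forall (C : set K) (x : K), closed C -> ~ C x ->
  exists f, [/\ Q f, forall y, C y -> f y = 0 & f x = 1].

(** The triples index themselves, so systems are ordered by inclusion. *)
Definition bidiscrete_set (S : set triple) : Prop :=
  (forall t, S t -> [/\ Q t.2, t.2 t.1.1 = 0 & t.2 t.1.2 = 1]) /\
  (forall t s, S t -> S s -> t <> s -> t.2 s.1.1 = t.2 s.1.2).

Lemma bidiscrete_set_bigcup (F : set (set triple)) :
    F `<=` bidiscrete_set -> total_on F subset ->
  bidiscrete_set (\bigcup_(S in F) S).
Proof.
move=> FS Ftot; split=> [t [S /FS [H _] /H //]|t s tF sF].
by have [S [/FS [_ H] St Ss]] := subset_of_two Ftot tF sF; exact: H.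
Qed.

Lemma bidiscrete_setU1 (S : set triple) (x0 x1 : K) (f : K -> R) :
    bidiscrete_set S -> Q f -> f x0 = 0 -> f x1 = 1 ->
    (forall t, S t -> t.2 x0 = t.2 x1) ->
    (forall t, S t -> f t.1.1 = f t.1.2) ->
  bidiscrete_set ((x0, x1, f) |` S).
Proof.
move=> [SQ Sdisc] Qf f0 f1 Sf fS; split=> [t [->|/SQ]//|t s].
by move=> [->|St] [->|Ss] ts //=; [exact: fS|exact: Sf|exact: Sdisc].
Qed.

(* Around a non-isolated point [p], a finite system whose functions all vanish
   near [p] can be enlarged by a pair [(p, x)] with [x] close to [p]. *)
Lemma infinite_bidiscrete_set :
  exists S : set triple, bidiscrete_set S /\ infinite_set S.
Proof.
have [p p_noniso] := nonisolated_point.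
pose near_p (t : triple) := t.1.1 = p /\ nbhs p [set y | t.2 y = 0].
have [F FP Ftot|S [[Sbi Sp] maxS]] :=
  @Zorn_bigcup _ (fun S => bidiscrete_set S /\ S `<=` near_p).
  split; first by apply: bidiscrete_set_bigcup => // S /FP [].
  by move=> t [S /FP [_ Sp]]; exact: Sp.
exists S; split=> // /finite_fsetP [D SD].
have [V [oV Vp VS]] : exists V : set K,
    [/\ open V, V p & forall t y, S t -> V y -> t.2 y = 0].
  have : nbhs p (\bigcap_(t in [set` D]) [set y | t.2 y = 0]).
    by apply: filter_bigI => t tD; apply: (Sp t _).2; rewrite SD.
  rewrite nbhsE => -[V [oV Vp] VD]; exists V; split=> // t y St /VD; apply.
  by rewrite -SD.
have [x Vx xp] : exists2 x, V x & x <> p.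
  apply: contrapT => nx; apply: p_noniso; suff -> : [set p] = V by [].
  apply/seteqP; split=> [_ ->//|y Vy].
  by apply: contrapT => yp; apply: nx; exists y.
move: Khausdorff; rewrite open_hausdorff => /(_ x p) [|[A B]]; first exact/eqP.
rewrite !inE /= => -[Ax Bp] [oA oB AB0].
have nAB y : A y -> ~ B y.
  by move=> Ay By; have : (A `&` B) y by []; rewrite AB0.
(* Vanishing outside [A] makes [f] zero on the neighborhood [B] of [p]. Vanishing outside [V] makes
   it zero at the second point of each [t] in [S], because [t.2] is 1 there and 0 on [V]. *)
have [|//|f [Qf f0 fx]] := @Qseparates (~` (A `&` V)) x.
  exact/open_closedC/openI.
  by apply; split.
have fp : f p = 0 by apply: f0 => -[/nAB].
have neq10 : (1 : R) <> 0 by move/eqP; rewrite oner_eq0.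
have nSx : ~ S (p, x, f).
  by move=> Sx; have := VS _ x Sx Vx; rewrite /= fx.
apply: (maxS ((p, x, f) |` S)).
  by split=> [t|/(_ (p, x, f) (or_introl erefl))//]; right.
split; last first.
  move=> t [->|/Sp//]; split=> //=; apply: filterS (open_nbhs_nbhs (conj oB Bp)).
  by move=> y By; apply: f0 => -[/nAB].
apply: bidiscrete_setU1 => // t St; first by rewrite !(VS t).
rewrite (Sp t St).1 fp f0// => -[_ /(VS _ _ St)].
by have [_ _ ->] := Sbi.1 t St.
Qed.

Lemma maximal_bidiscrete_set : exists S : set triple,
  [/\ bidiscrete_set S, infinite_set S &
      forall S', S `<` S' -> ~ bidiscrete_set S'].
Proof.
have [S0 [S0bi S0inf]] := infinite_bidiscrete_set.
have [F _|S [S0S Sbi maxS]] := Zorn_bigcup_above S0bi.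
  exact: bidiscrete_set_bigcup.
by exists S; split=> //; exact: sub_infinite_set S0S S0inf.
Qed.

(** * Half spaces and a dense set no larger than the system *)

Definition half_space (S : set triple) (i : S * (rat * bool)) : set K :=
  if i.2.2 then [set y | (val i.1).2 y < ratr i.2.1]
  else [set y | ratr i.2.1 < (val i.1).2 y].

Lemma open_half_space (S : set triple) i : bidiscrete_set S ->
  open (@half_space S i).
Proof.
move=> Sbi; have /Qcontinuous/continuousP ct : Q (val i.1).2.
  by have [] := Sbi.1 _ (set_valP i.1).
rewrite /half_space; case: i.2.2.
  by apply: (ct [set z | z < ratr i.2.1]); exact: open_lt.
by apply: (ct [set z | ratr i.2.1 < z]); exact: open_gt.
Qed.

Definition points (S : set triple) : set K :=
  [set t.1.1 | t in S] `|` [set t.1.2 | t in S].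

(* Were [x] outside the closure of the points not separated from some [y] by
   the functions of [S], the pair [(y, x)] would extend [S]. *)
Lemma maximal_separates (S : set triple) (x y : K) : bidiscrete_set S ->
    (forall S', S `<` S' -> ~ bidiscrete_set S') ->
    ~ closure (points S) x -> x <> y ->
  exists2 t, S t & t.2 x <> t.2 y.
Proof.
move=> Sbi maxS nSx xy; apply: contrapT => nsep.
have [||f [Qf f0 fx]] := @Qseparates (closure (points S) `|` [set y]) x.
- by apply: closedU; [exact: closed_closure|exact: closed_set1].
- by case.
have fsupp z : points S z -> f z = 0.
  by move=> Sz; apply: f0; left; exact: subset_closure.
apply: (maxS ((y, x, f) |` S)).
  split; first by move=> t; right.
  move=> /(_ (y, x, f) (or_introl erefl)) Sx; apply: nSx.
  by apply: subset_closure; right; exists (y, x, f).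
apply: bidiscrete_setU1 => //; first by apply: f0; right.
  by move=> t St; apply: contrapT => tyx; apply: nsep; exists t => // /esym.
by move=> t St; rewrite !fsupp//; [right|left]; exists t.
Qed.

(** For [y] outside [V], a rational strictly between two values of a function of [S] puts [x] and
    [y] in opposite half spaces. Those opposite to the ones around [x] cover the complement of [V],
    and [l] comes from a finite subcover. *)
Lemma half_space_base (S : set triple) (x : K) (V : set K) :
    bidiscrete_set S -> (forall S', S `<` S' -> ~ bidiscrete_set S') ->
    ~ closure (points S) x -> open V -> V x ->
  exists l : seq (S * (rat * bool)),
    (forall i, i \in l -> half_space i x) /\
    (forall y, (forall i, i \in l -> half_space i y) -> V y).
Proof.
move=> Sbi maxS nSx oV Vx.
have : compact (~` V).
  exact: (subclosed_compact (open_closedC oV) Kcompact).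
pose opp (i : S * (rat * bool)) := (i.1, (i.2.1, ~~ i.2.2)).
move=> /(compact_cover_compact x) /(_ _ [set i | half_space i x]
  (fun i => half_space (opp i))).
case=> [i _|y nVy|D Dx VD]; first exact: open_half_space.
  have [|t St txy] := @maximal_separates S x y Sbi maxS nSx.
    by move=> xy; apply: nVy; rewrite -xy.
  pose tS : S := SigSub (mem_set St).
  have /orP[lt|lt] : (t.2 x < t.2 y) || (t.2 y < t.2 x).
      by rewrite -neq_lt; exact/eqP.
  - have [q] := rat_in_itvoo lt; rewrite in_itv /= => /andP[xq qy].
    by exists (tS, (q, true)).
  - have [q] := rat_in_itvoo lt; rewrite in_itv /= => /andP[yq qx].
    by exists (tS, (q, false)).
exists (enum_fset D); split=> [i iD|y Dy].
  by have := Dx i iD; rewrite inE.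
apply: contrapT => /VD [i /Dy]; rewrite /half_space /opp /=.
by case: i.2.2 => /= h1 h2; have := lt_trans h1 h2; rewrite ltxx.
Qed.

Lemma maximal_dense (S : set triple) : bidiscrete_set S -> infinite_set S ->
    (forall S', S `<` S' -> ~ bidiscrete_set S') ->
  exists E : set K, dense E /\ E #<= S.
Proof.
move=> Sbi Sinf maxS.
have [t0 St0] := infinite_setN0 Sinf.
(* Labels [inl] stand for half spaces and labels [inr] for the two points of a triple, so that lists
   over one type name both kinds of points of the dense set. *)
pose C : countType := (rat * bool + bool)%type.
pose cell (l : seq (S * C)) : set K := [set y | forall t qb,
  (t, inl qb) \in l -> half_space (t, qb) y].
have /choice [h hP] : forall l, exists z, (cell l !=set0) -> cell l z.
  move=> l; have [[z lz]|nl] := pselect (cell l !=set0); first by exists z.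
  by exists t0.1.1.
pose k l := if l is [:: (t, inr b)] then
  (if b then (val t).1.1 else (val t).1.2) else h l.
exists (range k); split; last first.
  apply: (card_le_trans (card_image_le _ _)).
  have [i i_inj] : exists i : nat -> S, injective i.
    move/infiniteP: Sinf => /(card_le_inj t0) [i [iS i_inj]].
    exists (fun n => SigSub (mem_set (iS n I))) => m n /(congr1 val).
    exact: i_inj.
  have [g g_inj] := infinite_seq_countable i_inj C.
  apply: (card_le_trans (card_leT_inj g_inj)).
  by have /card_eqPle [] := card_setT S.
move=> O [x Ox] oO.
have [clx|nclx] := pselect (closure (points S) x).
  have [y [Sy Oy]] := clx O (open_nbhs_nbhs (conj oO Ox)).
  exists y; split=> //; case: Sy => -[t St <-].
    by exists [:: (SigSub (mem_set St), inr true)].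
  by exists [:: (SigSub (mem_set St), inr false)].
have [l [lx lO]] := half_space_base Sbi maxS nclx oO Ox.
pose l' : seq (S * C) := [seq (p.1, inl p.2) | p <- l].
have cellE y : cell l' y <-> (forall i, i \in l -> half_space i y).
  split=> [ly [t qb] il|ly t qb /mapP [[t' qb'] il [-> ->]]]; last exact: ly.
  by apply: ly; apply/mapP; exists (t, qb).
exists (k l'); split; last by exists l'.
(* All labels of [l'] are [inl], so [k] takes its default branch. *)
have -> : k l' = h l' by rewrite /l'; case: (l) => [|[? ?] []].
by apply/lO/cellE/hP; exists x; apply/cellE.
Qed.

Lemma dense_least_card :
  exists D : set K, dense D /\ forall E : set K, dense E -> D #<= E.
Proof.
have Tdense : dense [set: K] by move=> O O0 _; rewrite setIT.
have [[D Ddense] leD] :=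
  @card_le_least K {E : set K | dense E} sval (exist _ setT Tdense).
by exists D; split=> // E Edense; exact: (leD (exist _ E Edense)).
Qed.

(** The system [S] may be larger than [d(K)]; a least dense set [D], injected into [S], indexes a
    subsystem of the exact size. *)
Lemma bidiscrete_density : exists (I : Type) (x0 x1 : I -> K) (f : I -> K -> R),
  [/\ has_density_card K [set: I], bidiscrete_witness x0 x1 f
    & forall a, Q (f a)].
Proof.
have [S [Sbi Sinf maxS]] := maximal_bidiscrete_set.
have [t0 St0] := infinite_setN0 Sinf.
have [E [Edense leES]] := maximal_dense Sbi Sinf maxS.
have [D [Ddense leD]] := dense_least_card.
have [g [gS g_inj]] := card_le_inj t0 (card_le_trans (leD E Edense) leES).
have gSv (a : D) : S (g (val a)) by apply: gS; exact: set_valP.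
exists D, (fun a => (g (val a)).1.1), (fun a => (g (val a)).1.2),
  (fun a => (g (val a)).2).
have gP a := Sbi.1 _ (gSv a).
split; [by exists D|split|by move=> a; have [] := gP a].
- by move=> a; apply: Qcontinuous; have [] := gP a.
- by move=> a; have [] := gP a.
- move=> a b ab; apply: Sbi.2 => // gab; apply: ab; apply: val_inj.
  by apply: g_inj gab; exact: set_valP.
Qed.

End topology.

(** * Urysohn functions for the two claims *)

Lemma urysohn_point (R : realType) (K : topologicalType) (C : set K) (x : K) :
    compact [set: K] -> hausdorff_space K -> closed C -> ~ C x ->
  exists f : K -> R, [/\ continuous f, forall y, C y -> f y = 0 & f x = 1].
Proof.
move=> Kc Kh clC nCx.
have : uniform_separator C [set x].
  apply: normal_uniform_separator => //; first exact: compact_normal.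
    exact: closed_set1.
  by apply/seteqP; split=> // y [Cy yx]; apply: nCx; rewrite -yx.
move=> /(uniform_separatorP (R := R)) [f [fc _ fC fx]].
exists f; split=> // [y Cy|]; first by apply: fC; exists y.
by apply: fx; exists x.
Qed.

Lemma clopen_urysohn_point (R : realType) (K : topologicalType) (C : set K)
    (x : K) : has_clopen_base K -> closed C -> ~ C x ->
  exists f : K -> R, [/\ continuous f /\ (forall y, f y = 0 \/ f y = 1),
    forall y, C y -> f y = 0 & f x = 1].
Proof.
move=> [B [[_ Bbase] Bclopen]] clC nCx.
have [|H [BH Hx] HC] := Bbase x (~` C).
  by apply: open_nbhs_nbhs; split=> //; exact: closed_openC.
have [oH clH] := Bclopen _ BH.
pose f y : R := if y \in H then 1 else 0.
have fH y : H y -> f y = 1 by move=> Hy; rewrite /f mem_set.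
have fnH y : ~ H y -> f y = 0 by move=> Hy; rewrite /f memNset.
exists f; split=> [|y Cy|]; last exact: fH; last first.
  by apply: fnH => /HC.
split; last by move=> y; rewrite /f; case: ifP; [right|left].
(* Continuity holds because [f] is constant on [H] and on its complement, both open. *)
move=> y A /nbhs_singleton Afy; have [Hy|nHy] := pselect (H y).
  apply: filterS (open_nbhs_nbhs (conj oH Hy)) => z Hz /=.
  by rewrite fH// -(fH y).
apply: filterS (open_nbhs_nbhs (conj (closed_openC clH) nHy)) => z nHz /=.
by rewrite fnH// -(fnH y).
Qed.

Theorem theorem4p5 (R : realType) (K : topologicalType)
    (Kinfinite : infinite_set [set: K])
    (Kcompact : compact [set: K])
    (Khausdorff : hausdorff_space K) :
  (exists (I : Type) (x0 x1 : I -> K),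
     has_density_card K [set: I] /\ bidiscrete R x0 x1) /\
  (has_clopen_base K ->
   exists (I : Type) (x0 x1 : I -> K),
     has_density_card K [set: I] /\ very_nice_bidiscrete R x0 x1).
Proof.
split=> [|Kclopen].
  have [//|C x|I [x0 [x1 [f [dI fP _]]]]] := @bidiscrete_density R K
    Kinfinite Kcompact Khausdorff [set f : K -> R | continuous f].
    exact: urysohn_point.
  by exists I, x0, x1; split=> //; exists f.
have [f []//|C x|I [x0 [x1 [f [dI fP f01]]]]] := @bidiscrete_density R K
  Kinfinite Kcompact Khausdorff
  [set f : K -> R | continuous f /\ forall y, f y = 0 \/ f y = 1].
  exact: clopen_urysohn_point.
exists I, x0, x1; split=> //; exists f; split=> // a.
by have [] := f01 a.
Qed.
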